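(* Let $\mathcal{F}$ be a generating family on a topological group $G$. Then the coarse structure $\mathcal{E}_{\mathcal{F}}$ is compatible with the topology of $G$ if and only if there exists an open set $U$ containing the identity of $G$ such that $U\in\hat{\mathcal{F}}$.
   Context: For subsets $A,B$ of a group $G$ put $AB=\{gh\mid g\in A,h\in B\}$ and $A^{-1}=\{g^{-1}\mid g\in A\}$. A generating family $\mathcal{F}$ on $G$ is a family of subsets of $G$ that contains a nonempty subset of $G$ and such that $A\cup B$, $AB$, $A^{-1}\in\mathcal{F}$ for all $A,B\in\mathcal{F}$. Standing assumption: every generating family satisfies $G=\bigcup_{F\in\mathcal{F}}F$. $\hat{\mathcal{F}}$ denotes the family of all subsets $A\subseteq G$ such that $A\subseteq B$ for some $B\in\mathcal{F}$. $\mathcal{E}_{\mathcal{F}}$ denotes the coarse structure on $G$ consisting of all $E\subseteq G\times G$ such that $E\subseteq G(F\times F):=\{(ga,gb)\mid g\in G,\ a,b\in F\}$ for some $F\in\mathcal{F}$. A coarse structure $\mathcal{E}$ on a topological space $X$ is compatible with the topology of $X$ if there exists $E\in\mathcal{E}$ which is open in the product topology of $X\times X$ and contains the diagonal $\{(x,x)\mid x\in X\}$. *)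

(* Defs.v *)
From HB Require Import structures.
From mathcomp Require Import all_boot.
From mathcomp Require Import boolp classical_sets functions topology.

Set Implicit Arguments.
Unset Strict Implicit.
Unset Printing Implicit Defensive.

Local Open Scope group_scope.
Local Open Scope classical_set_scope.

HB.structure Definition PreTopologicalGroup :=
  {G of Topological G & Group G}.

HB.mixin Record PreTopologicalGroup_isTopologicalGroup G
    & PreTopologicalGroup G := {
  mulg_continuous : continuous (fun x : G * G => x.1 * x.2) ;
  invg_continuous : continuous (fun x : G => x^-1)
}.

(* No separation axiom is assumed. *)
#[short(type="topologicalGroupType")]
HB.structure Definition TopologicalGroup :=
  {G of PreTopologicalGroup G & PreTopologicalGroup_isTopologicalGroup G}.

Definition mul_set (G : groupType) (A B : set G) : set G :=
  [set g * h | g in A & h in B].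

Definition inv_set (G : groupType) (A : set G) : set G :=
  [set g^-1 | g in A].

Record generatingFamily (G : groupType) := GeneratingFamily {
  family_sets : set (set G) ;
  family_nonempty : exists2 A, family_sets A & A !=set0 ;
  family_setU : forall A B,
    family_sets A -> family_sets B -> family_sets (A `|` B) ;
  family_mul : forall A B,
    family_sets A -> family_sets B -> family_sets (mul_set A B) ;
  family_inv : forall A, family_sets A -> family_sets (inv_set A) ;
  family_cover : \bigcup_(A in family_sets) A = setT
}.

Definition family_hat (G : groupType) (F : generatingFamily G) : set (set G) :=
  [set A | exists2 B, family_sets F B & A `<=` B].

(* Coarse structure in the sense of Roe. In relation_scope, [E' \; E] relates
   x to z when E (x, y) and E' (y, z) for some y. *)
Record coarseStructure (X : Type) := CoarseStructure {
  controlled : set (set (X * X)) ;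
  controlled_diagonal : controlled diagonal ;
  controlled_sub : forall E E',
    controlled E -> E' `<=` E -> controlled E' ;
  controlled_setU : forall E E',
    controlled E -> controlled E' -> controlled (E `|` E') ;
  controlled_inv : forall E,
    controlled E -> controlled (E^-1)%relation ;
  controlled_comp : forall E E', controlled E -> controlled E' ->
    controlled (E' \; E)%relation
}.

Definition compatible (X : topologicalType) (C : coarseStructure X) : Prop :=
  exists E : set (X * X), [/\ controlled C E, open E & diagonal `<=` E].

Section GroupCoarse.
Variables (G : groupType) (F : generatingFamily G).

(* The set G(A x A). *)
Definition translates (A : set G) : set (G * G) :=
  [set xy | exists g a b, [/\ A a, A b & xy = (g * a, g * b)]].

Definition group_controlled : set (set (G * G)) :=
  [set E | exists2 A, family_sets F A & E `<=` translates A].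

Lemma group_controlled_diagonal :
  group_controlled diagonal.
Proof.
have [A FA [a Aa]] := family_nonempty F.
exists A => // -[x y] /= /diagonalP <-; exists (x * a^-1), a, a; split=> //.
by rewrite mulgVK.
Qed.

Lemma group_controlled_sub E E' :
  group_controlled E -> E' `<=` E -> group_controlled E'.
Proof. by move=> [A FA EA] E'E; exists A => //; apply: subset_trans EA. Qed.

Lemma group_controlled_setU E E' :
  group_controlled E -> group_controlled E' -> group_controlled (E `|` E').
Proof.
move=> [A FA EA] [B FB EB]; exists (A `|` B); first exact: family_setU.
move=> xy [/EA|/EB] [g [a [b [Ha Hb ->]]]]; exists g, a, b;
  by split=> //; ((by left) || (by right)).
Qed.

Lemma group_controlled_inv E :
  group_controlled E -> group_controlled (E^-1)%relation.
Proof.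
move=> [A FA EA]; exists A => // -[x y] /= /EA [g [a [b [Ha Hb [-> ->]]]]].
by exists g, b, a.
Qed.

Lemma group_controlled_comp E E' :
  group_controlled E -> group_controlled E' ->
  group_controlled (E' \; E)%relation.
Proof.
move=> [A FA EA] [B FB EB].
exists (A `|` mul_set A (mul_set (inv_set B) B)).
  by do ![apply: family_setU | apply: family_mul | apply: family_inv].
move=> [x z] [y /= /EA [g [a [a' [Aa Aa' [-> ->]]]]]].
move=> /EB [h [b [b' [Bb Bb' [gh ->]]]]].
exists g, a, (a' * (b^-1 * b')); split; [by left| |].
  right; exists a' => //; exists (b^-1 * b') => //.
  by exists b^-1; [exists b|exists b'].
by rewrite !mulgA gh mulgK.
Qed.

Definition group_coarse : coarseStructure G :=
  CoarseStructure group_controlled_diagonal group_controlled_sub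
    group_controlled_setU group_controlled_inv group_controlled_comp.

End GroupCoarse.

(* Main.v *)
Require Import Defs.
From HB Require Import structures.
From mathcomp Require Import all_boot.
From mathcomp Require Import boolp classical_sets functions topology.

Set Implicit Arguments.
Unset Strict Implicit.
Unset Printing Implicit Defensive.

Local Open Scope group_scope.
Local Open Scope classical_set_scope.

(** Entourages and identity neighbourhoods determine each other: slicing an open entourage at [1]
    gives [U], and conversely [U] spreads to the left-invariant relation [x^-1 * y \in U], which is
    open because left division is jointly continuous ([ldivg_continuous]). *)

Lemma ldivg_continuous (G : topologicalGroupType) :
  continuous (fun x : G * G => x.1^-1 * x.2).
Proof.
move=> x; apply: (@continuous_comp _ _ _
  (fun x : G * G => (x.1^-1, x.2)) (fun y : G * G => y.1 * y.2)).
  apply: cvg_pair => /=; last exact: cvg_snd.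
  apply: (@continuous_comp _ _ _ fst (fun y : G => y^-1)).
    exact: cvg_fst.
  exact: invg_continuous.
exact: mulg_continuous.
Qed.

Theorem proposition3p6 (G : topologicalGroupType) (F : generatingFamily G) :
  compatible (group_coarse F) <->
  exists U : set G, [/\ open U, U 1 & family_hat F U].
Proof.
split=> [[E [[A FA EA] oE dE]]|[U [oU U1 [B FB UB]]]].
  exists [set y | E (1, y)]; split.
  - apply: (@open_comp _ _ (fun y : G => (1, y))) => // y _.
    by apply: cvg_pair; [exact: cvg_cst|exact: cvg_id].
  - exact/dE/diagonalP.
  (* If [(1, y) = (g * a, g * b)], then [g = a^-1], so [y = a^-1 * b]: the slice lies in the product
     of [inv_set A] and [A]. *)
  - exists (mul_set (inv_set A) A); first exact/family_mul/FA/family_inv.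
    move=> y /= /EA [g [a [b [Aa Ab [/esym ga1 ->]]]]].
    exists a^-1; first by exists a.
    by exists b => //; rewrite -(mulg1_eq ga1) invgK.
exists [set xy | U (xy.1^-1 * xy.2)]; split.
- exists B => // -[x y] /= Uxy.
  (* Translating by [x] uses the pair [(1, x^-1 * y)]; both entries lie in [U], hence in the same
     [B]. *)
  exists x, 1, (x^-1 * y); split; [exact: UB|exact: UB|].
  by rewrite mulg1 mulgA mulgV mul1g.
- by apply: open_comp => // xy _; exact: ldivg_continuous.
- by move=> [x y] /diagonalP <- /=; rewrite mulVg.
Qed.
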